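(* Let $G_i=\langle X_i\mid R_i(X_i)\rangle$ be presentations of groups $G_i$ ($1\le i\le m$). For each $1<i\le m$ let $T_i\subseteq G_i$ be a subset such that $T_i\cap T_i^{-1}=\emptyset$ and $T_i\cup T_i^{-1}=G_i\setminus\{1\}$, where $T_i^{-1}=\{t^{-1}\mid t\in T_i\}$. Then the multiple wreath product $W=(\dots((G_1\wr G_2)\wr G_3)\dots)\wr G_m$ has the presentation with generators $\bigcup_{i=1}^m X_i$ (disjoint union) and defining relations $$R_i(X_i)\quad (1\le i\le m),\qquad [x,t^{-1}yt]=1\ \text{ for all } 1<j\le m,\ x,y\in \bigcup_{i<j}X_i,\ t\in T_j .$$ If, moreover, all the given presentations of the groups $G_i$ ($1\le i\le m$) are minimal and the sets of generators $X_i$ ($1\le i<m$) are conormal, then this presentation of $W$ is minimal as well.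
   Context: For groups $G,H$, let $H^G$ be the group (under pointwise multiplication) of all maps $f:G\to H$ with finite support, i.e. $f(x)=1$ for all but finitely many $x\in G$. The (restricted regular) wreath product is the semidirect product $H\wr G=H^G\rtimes G$ with respect to the action of $G$ on $H^G$ in which $g\in G$ sends $f$ to the map $a\mapsto f(ag)$. Writing $h(a)$ ($h\in H$, $a\in G$) for the map with value $h$ at $a$ and $1$ elsewhere, conjugation in $H\wr G$ is given by $g^{-1}h(a)g=h(ag)$. In $H\wr G$, the group $G$ is regarded as a subgroup in the obvious way, and $H$ is identified with the subgroup $\{h(1)\mid h\in H\}$ of $H^G$; iterating, each $G_i$, and hence each $X_i$, is regarded as contained in the multiple wreath product. In a relation, $t\in T_j$ stands for a word in $X_j$ representing $t$. $\langle X\mid R(X)\rangle$ denotes a presentation with set of generators $X$ and set of defining relations $R(X)$. A presentation is called minimal if none of its generators and none of its defining relations can be excluded (i.e. no proper subset of the set of generators generates the group, and no defining relation is a consequence of the other defining relations). A set of generators $X$ of a group is called conormal if no element $x\in X$ belongs to the normal subgroup $N_x$ generated (as a normal subgroup) by all elements of $X\setminus\{x\}$. *)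

(* Defs.v *)
From HB Require Import structures.
From mathcomp Require Import all_boot finmap classical_sets.

Set Implicit Arguments.
Unset Strict Implicit.
Unset Printing Implicit Defensive.

Local Open Scope classical_set_scope.
Local Open Scope fset_scope.
Local Open Scope group_scope.

Definition is_subgroup (G : groupType) (S : set G) : Prop :=
  [/\ S 1, forall x y, S x -> S y -> S (x * y) & forall x, S x -> S x^-1].

Definition is_normal_subgroup (G : groupType) (S : set G) : Prop :=
  is_subgroup S /\ forall x g, S x -> S (x ^ g).

Definition generates (G : groupType) (A : set G) : Prop :=
  smallest (@is_subgroup G) A = setT.

Definition normal_closure (G : groupType) (A : set G) : set G :=
  smallest (@is_normal_subgroup G) A.

(* The letter [(x, true)] is the generator x, and [(x, false)] is x^-1. Words
   need not be reduced.                                                       *)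
Definition word (X : Type) : Type := seq (X * bool).

Definition letter_inv (X : Type) (l : X * bool) : X * bool := (l.1, ~~ l.2).

Definition word_gen (X : Type) (x : X) : word X := [:: (x, true)].

Definition word_inv (X : Type) (w : word X) : word X :=
  rev (map (@letter_inv X) w).

Definition word_conj (X : Type) (u v : word X) : word X :=
  word_inv v ++ u ++ v.

Definition word_comm (X : Type) (u v : word X) : word X :=
  word_inv u ++ word_inv v ++ u ++ v.

Definition word_map (X Y : Type) (f : X -> Y) (w : word X) : word Y :=
  map (fun l => (f l.1, l.2)) w.

Definition word_eval (X : Type) (G : groupType) (phi : X -> G) (w : word X)
    : G :=
  \prod_(l <- w) (if l.2 then phi l.1 else (phi l.1)^-1).

(* Equality of words in the group < X | r = 1, r \in R >: the equivalence
   relation generated by the insertion and deletion of subwords l l^-1 and of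
   subwords r \in R.                                                          *)
Inductive word_eq (X : Type) (R : set (word X)) : word X -> word X -> Prop :=
| word_eq_refl u : word_eq R u u
| word_eq_sym u v : word_eq R u v -> word_eq R v u
| word_eq_trans u v w : word_eq R u v -> word_eq R v w -> word_eq R u w
| word_eq_free u v l : word_eq R (u ++ [:: l; letter_inv l] ++ v) (u ++ v)
| word_eq_rel u v r : R r -> word_eq R (u ++ r ++ v) (u ++ v).

(* [w] is a consequence of [R]: its class in the free group on [X] lies in the
   normal closure of [R].                                                     *)
Definition consequence (X : Type) (R : set (word X)) (w : word X) : Prop :=
  word_eq R w [::].

(* The set X of generators is an abstract type with a map [phi] to G, which is
   not required to be injective: in a presentation two generators may represent
   the same element of G.                                                     *)
Definition is_presentation (X : Type) (G : groupType) (phi : X -> G)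
    (R : set (word X)) : Prop :=
  generates (range phi) /\
  forall w : word X, word_eval phi w = 1 <-> consequence R w.

Definition is_minimal_presentation (X : Type) (G : groupType) (phi : X -> G)
    (R : set (word X)) : Prop :=
  [/\ is_presentation phi R,
      forall Y : set X, (Y `<` setT)%classic -> ~ generates (phi @` Y) &
      forall r, R r -> ~ consequence (R `\ r)%classic r].

Definition is_conormal (X : Type) (G : groupType) (phi : X -> G) : Prop :=
  forall x : X, ~ normal_closure (phi @` [set y | y <> x]) (phi x).

(* The group H^G, under pointwise multiplication. *)
Definition fpower (H G : groupType) : Type := {fsfun G -> H with 1}.

HB.instance Definition _ (H G : groupType) :=
  Choice.copy (fpower H G) {fsfun G -> H with 1}.

Section FPower.
Variables H G : groupType.
Implicit Types f : fpower H G.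

Definition fpower_app f : G -> H := (f : {fsfun G -> H with 1}).
Local Notation "f $ a" := (fpower_app f a) (at level 9, a at level 9).

Lemma fpowerP f1 f2 : fpower_app f1 =1 fpower_app f2 -> f1 = f2.
Proof. by move=> e; apply/fsfunP. Qed.

Lemma fpower_out f a : a \notin finsupp f -> f $ a = 1.
Proof. exact: fsfun_dflt. Qed.

Definition fpower_one : fpower H G := [fsfun with 1].

Definition fpower_mul f1 f2 : fpower H G :=
  [fsfun a in (finsupp f1 `|` finsupp f2)%fset => f1 $ a * f2 $ a | 1].

Definition fpower_inv f : fpower H G :=
  [fsfun a in finsupp f => (f $ a)^-1 | 1].

Lemma fpower_oneE a : fpower_one $ a = 1.
Proof. by rewrite /fpower_app fsfunE. Qed.

Lemma fpower_mulE f1 f2 a : (fpower_mul f1 f2) $ a = f1 $ a * f2 $ a.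
Proof.
rewrite {1}/fpower_app fsfunE inE.
case: ifP => // /norP[n1 n2]; by rewrite !fpower_out ?mulg1.
Qed.

Lemma fpower_invE f a : (fpower_inv f) $ a = (f $ a)^-1.
Proof.
rewrite {1}/fpower_app fsfunE; case: ifP => // /negbT n1.
by rewrite fpower_out ?invg1.
Qed.

Fact fpower_mulA : associative fpower_mul.
Proof. by move=> x y z; apply: fpowerP => a; rewrite !fpower_mulE mulgA. Qed.

Fact fpower_mul1 : left_id fpower_one fpower_mul.
Proof.
by move=> x; apply: fpowerP => a; rewrite fpower_mulE fpower_oneE mul1g.
Qed.

Fact fpower_mulg1 : right_id fpower_one fpower_mul.
Proof.
by move=> x; apply: fpowerP => a; rewrite fpower_mulE fpower_oneE mulg1.
Qed.

Fact fpower_mulV : left_inverse fpower_one fpower_inv fpower_mul.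
Proof.
move=> x; apply: fpowerP => a.
by rewrite fpower_mulE fpower_invE fpower_oneE mulVg.
Qed.

Fact fpower_mulgV : right_inverse fpower_one fpower_inv fpower_mul.
Proof.
move=> x; apply: fpowerP => a.
by rewrite fpower_mulE fpower_invE fpower_oneE mulgV.
Qed.

HB.instance Definition _ := isGroup.Build (fpower H G)
  fpower_mulA fpower_mul1 fpower_mulg1 fpower_mulV fpower_mulgV.

Lemma fpower1E a : (1 : fpower H G) $ a = 1.
Proof. exact: fpower_oneE. Qed.

Lemma fpowerME f1 f2 a : (f1 * f2) $ a = f1 $ a * f2 $ a.
Proof. exact: fpower_mulE. Qed.

Lemma fpowerVE f a : (f^-1) $ a = (f $ a)^-1.
Proof. exact: fpower_invE. Qed.

(* The map written h(a): value h at a, and 1 elsewhere. *)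
Definition fpower_at (h : H) (a : G) : fpower H G :=
  [fsfun b in [fset a] => h | 1].

Lemma fpower_atE h a b : (fpower_at h a) $ b = if b == a then h else 1.
Proof. by rewrite /fpower_app fsfunE inE. Qed.

(* With g f g^-1 for this action, g^-1 h(a) g = h(ag); see [wreath_conj]. *)
Definition fpower_act (g : G) f : fpower H G :=
  [fsfun a in [fset b * g^-1 | b in finsupp f] => f $ (a * g) | 1].

Lemma fpower_actE g f a : (fpower_act g f) $ a = f $ (a * g).
Proof.
rewrite {1}/fpower_app fsfunE; case: ifP => // /negbT n1.
rewrite fpower_out //; apply: contra n1 => n1.
by apply/imfsetP; exists (a * g) => //=; rewrite mulgK.
Qed.

Lemma fpower_act1 f : fpower_act 1 f = f.
Proof. by apply: fpowerP => a; rewrite fpower_actE mulg1. Qed.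

Lemma fpower_actM g1 g2 f :
  fpower_act (g1 * g2) f = fpower_act g1 (fpower_act g2 f).
Proof. by apply: fpowerP => a; rewrite !fpower_actE mulgA. Qed.

Lemma fpower_act_mul g f1 f2 :
  fpower_act g (f1 * f2) = fpower_act g f1 * fpower_act g f2.
Proof. by apply: fpowerP => a; rewrite fpowerME !fpower_actE fpowerME. Qed.

Lemma fpower_act_one g : fpower_act g 1 = 1.
Proof. by apply: fpowerP => a; rewrite fpower_actE !fpower1E. Qed.

Lemma fpower_act_inv g f : fpower_act g f^-1 = (fpower_act g f)^-1.
Proof. by apply: fpowerP => a; rewrite fpowerVE !fpower_actE fpowerVE. Qed.

End FPower.

(* [WreathElt f g] stands for the product f g, with f \in H^G and g \in G. *)
Record wreath (H G : groupType) : Type :=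
  WreathElt { wreath_base : fpower H G; wreath_top : G }.

Section Wreath.
Variables H G : groupType.

Definition wreath_pair (u : wreath H G) : fpower H G * G :=
  (wreath_base u, wreath_top u).

Definition wreath_of_pair (p : fpower H G * G) : wreath H G :=
  WreathElt p.1 p.2.

Fact wreath_pairK : cancel wreath_pair wreath_of_pair.
Proof. by case. Qed.

HB.instance Definition _ := Choice.copy (wreath H G) (can_type wreath_pairK).

Definition wreath_one : wreath H G := WreathElt 1 1.

Definition wreath_mul (u v : wreath H G) : wreath H G :=
  WreathElt (wreath_base u * fpower_act (wreath_top u) (wreath_base v))
            (wreath_top u * wreath_top v).

Definition wreath_inv (u : wreath H G) : wreath H G :=
  WreathElt (fpower_act (wreath_top u)^-1 (wreath_base u)^-1)
            (wreath_top u)^-1.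

Fact wreath_mulA : associative wreath_mul.
Proof.
case=> [f1 g1] [f2 g2] [f3 g3]; rewrite /wreath_mul /=.
by rewrite fpower_act_mul fpower_actM !mulgA.
Qed.

Fact wreath_mul1 : left_id wreath_one wreath_mul.
Proof. by case=> f g; rewrite /wreath_mul /= fpower_act1 !mul1g. Qed.

Fact wreath_mulg1 : right_id wreath_one wreath_mul.
Proof. by case=> f g; rewrite /wreath_mul /= fpower_act_one !mulg1. Qed.

Fact wreath_mulV : left_inverse wreath_one wreath_inv wreath_mul.
Proof.
case=> f g; rewrite /wreath_mul /= -fpower_act_mul !mulVg.
by rewrite fpower_act_one.
Qed.

Fact wreath_mulgV : right_inverse wreath_one wreath_inv wreath_mul.
Proof.
by case=> f g; rewrite /wreath_mul /= -fpower_actM !mulgV fpower_act1 mulgV.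
Qed.

HB.instance Definition _ := isGroup.Build (wreath H G)
  wreath_mulA wreath_mul1 wreath_mulg1 wreath_mulV wreath_mulgV.

Definition wreath_inl (h : H) : wreath H G := WreathElt (fpower_at h 1) 1.

Definition wreath_inr (g : G) : wreath H G := WreathElt 1 g.

Lemma wreath_conj (h : H) (a g : G) :
  WreathElt (fpower_at h a) 1 ^ wreath_inr g = WreathElt (fpower_at h (a * g)) 1.
Proof.
rewrite /conjg -[LHS]/(wreath_mul (wreath_inv _) (wreath_mul _ _)).
rewrite /wreath_mul /= mul1g mulVg; congr WreathElt.
apply: fpowerP => b; rewrite fpowerME !fpower_actE fpowerVE fpowerME.
rewrite fpower_actE !fpower1E invg1 mul1g mulg1 !fpower_atE.
by congr (if _ then _ else _); apply/eqP/eqP => [<-|->]; rewrite ?mulgVK ?mulgK.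
Qed.

End Wreath.

(* Indices start at 0: (... ((G 0 wr G 1) wr G 2) ...) wr G k. *)
Fixpoint iter_wreath (G : nat -> groupType) (k : nat) : groupType :=
  if k is k'.+1 then wreath (iter_wreath G k') (G k) else G 0%N.

Definition last_embed (G : nat -> groupType) (k : nat) :
    G k -> iter_wreath G k :=
  match k with
  | 0 => id
  | k'.+1 => @wreath_inr (iter_wreath G k') (G k'.+1)
  end.

(* The embedding of G i as a subgroup of [iter_wreath G k]; it is meaningful
   for i <= k only, and is trivial for k < i.                                 *)
Fixpoint iter_embed (G : nat -> groupType) (k i : nat) (g : G i) :
    iter_wreath G k :=
  match @eqP _ i k with
  | ReflectT e => last_embed (ecast j (G j) e g)
  | ReflectF _ =>
      match k return iter_wreath G k with
      | 0 => 1
      | k'.+1 => @wreath_inl (iter_wreath G k') (G k'.+1) (iter_embed k' g)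
      end
  end.

Lemma iter_embed_last (G : nat -> groupType) (k : nat) (g : G k) :
  iter_embed k g = last_embed g.
Proof. by case: k g => [|k] g /=; case: eqP => // e; rewrite eq_axiomK. Qed.

Lemma iter_embedS (G : nat -> groupType) (k i : nat) (g : G i) : (i <= k)%N ->
  iter_embed k.+1 g = wreath_inl (G k.+1) (iter_embed k g).
Proof. by move=> ik /=; case: eqP => // e; exfalso; move: ik; rewrite e ltnn. Qed.

Definition union_gen (m : nat) (X : nat -> Type) : Type :=
  {i : 'I_m.+1 & X i}.

Definition union_inj (m : nat) (X : nat -> Type) (i : 'I_m.+1) (x : X i) :
    union_gen m X :=
  existT (fun j : 'I_m.+1 => X j) i x.

Definition union_map (m : nat) (G : nat -> groupType) (X : nat -> Type)
    (phi : forall i, X i -> G i) (x : union_gen m X) : iter_wreath G m :=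
  iter_embed m (phi (projT1 x) (projT2 x)).

(* The relators of all the R i, and the relators [x, t^-1 y t] for t \in T j
   and x, y in the union of the X i with i < j; here [tw j t] is the word in
   X j that is used to write t.                                               *)
Definition wreath_relators (m : nat) (G : nat -> groupType) (X : nat -> Type)
    (R : forall i, set (word (X i))) (T : forall i, set (G i))
    (tw : forall i, G i -> word (X i)) : set (word (union_gen m X)) :=
  [set w | exists (i : 'I_m.+1) (r : word (X i)),
     R i r /\ w = word_map (@union_inj m X i) r] `|`
  [set w | exists (j : 'I_m.+1) (x y : union_gen m X) (t : G j),
     [/\ (0 < j)%N, (projT1 x < j)%N, (projT1 y < j)%N, T j t &
         w = word_comm (word_gen x)
               (word_conj (word_gen y) (word_map (@union_inj m X j) (tw j t)))]].

(* Main.v *)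
From HB Require Import structures.
Require Import Defs.
From mathcomp Require Import all_boot finmap boolp classical_sets.

(* Presentation: in a group where all relators hold, a word in the generators
   of H wr G is a product of conjugates b^a (b over H, a over G) times a word
   over G.  Conjugates with different a in G commute by the relators, so those
   with the same a can be collected into a single (b_1 ... b_n)^a, where
   b_1 ... b_n is the value at a of the base component.

   Minimality of the generators: below the top level, adding all generators but
   z as relators leaves a nontrivial cyclic quotient, by conormality; at the top
   level, project to G_m.

   Minimality of the relators: drop r from R_i and form the iterated wreath
   product of the weaker groups; r survives there.  For the relator
   [x, t^-1 y t] with t in T_j, let K_x, K_y be the cyclic quotients that kill
   all generators but x, resp. y, put Q = K_x wr K_y (so the images of x and y
   in Q do not commute), and let a generator z of level < j act as the element
   of Q wr G_j whose value is (image of z in K_y) at 1 and (image of z in K_x)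
   at t.  Among the relators of level j only [x, t^-1 y t] compares the value
   of its first entry at t with that of its second entry at 1, because
   T_j does not contain t^-1; all the others hold.                             *)

Set Implicit Arguments.
Unset Strict Implicit.
Unset Printing Implicit Defensive.

Local Open Scope classical_set_scope.
Local Open Scope group_scope.

(** * Homomorphisms and commuting elements *)

Section GroupFacts.
Variables (G H : groupType) (f : G -> H).
Hypothesis fM : {morph f : x y / x * y}.

Lemma morph_group1 : f 1 = 1.
Proof. by apply: (mulgI (f 1)); rewrite -fM !mulg1. Qed.

Lemma morph_groupV x : f x^-1 = (f x)^-1.
Proof. by apply/esym/mulg1_eq; rewrite -fM mulgV morph_group1. Qed.

Lemma morph_groupJ x y : f (x ^ y) = f x ^ f y.
Proof. by rewrite !conjgE !fM morph_groupV. Qed.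

Lemma morph_groupR x y : f [~ x, y] = [~ f x, f y].
Proof. by rewrite /commg fM morph_groupV morph_groupJ. Qed.

Lemma morph_commute x y : commute x y -> commute (f x) (f y).
Proof. by rewrite /commute -!fM => ->. Qed.

End GroupFacts.

Lemma commute_conj (G : groupType) (x y g : G) :
  commute x y -> commute (x ^ g) (y ^ g).
Proof. by rewrite /commute -!conjMg => ->. Qed.

(** * Evaluation of words in a group *)

Section Words.
Variables (X : Type) (G : groupType).
Implicit Types (phi : X -> G) (u v w : word X).

Lemma letter_invK : involutive (@letter_inv X).
Proof. by case=> x b; rewrite /letter_inv /= negbK. Qed.

Lemma word_eval_nil phi : word_eval phi [::] = 1.
Proof. by rewrite /word_eval big_nil. Qed.

Lemma word_eval_cons phi l w :
  word_eval phi (l :: w) =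
  (if l.2 then phi l.1 else (phi l.1)^-1) * word_eval phi w.
Proof. by rewrite /word_eval big_cons. Qed.

Lemma word_eval_gen phi x : word_eval phi (word_gen x) = phi x.
Proof. by rewrite word_eval_cons word_eval_nil mulg1. Qed.

Lemma word_eval_cat phi u v :
  word_eval phi (u ++ v) = word_eval phi u * word_eval phi v.
Proof. exact: big_cat. Qed.

Lemma word_eval_inv phi w : word_eval phi (word_inv w) = (word_eval phi w)^-1.
Proof.
elim: w => [|[x b] w IH]; first by rewrite /word_inv /= word_eval_nil invg1.
rewrite /word_inv /= rev_cons -cats1 word_eval_cat -/(word_inv w) IH.
rewrite !word_eval_cons word_eval_nil invgM mulg1.
by congr (_ * _); case: b; rewrite //= invgK.
Qed.

Lemma word_eval_conj phi u v :
  word_eval phi (word_conj u v) = word_eval phi u ^ word_eval phi v.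
Proof. by rewrite /word_conj !word_eval_cat word_eval_inv. Qed.

Lemma word_eval_comm phi u v :
  word_eval phi (word_comm u v) = [~ word_eval phi u, word_eval phi v].
Proof. by rewrite /word_comm !word_eval_cat !word_eval_inv. Qed.

Lemma word_eval_map (Y : Type) (f : Y -> X) phi (w : word Y) :
  word_eval phi (word_map f w) = word_eval (phi \o f) w.
Proof. by rewrite /word_eval big_map. Qed.

Lemma eq_word_eval phi phi' w :
  phi =1 phi' -> word_eval phi w = word_eval phi' w.
Proof. by move=> e; apply: eq_bigr => l _; rewrite e. Qed.

Lemma word_eval_1 w : word_eval (fun=> 1 : G) w = 1.
Proof. by apply: big1 => l _; rewrite invg1; case: ifP. Qed.

Lemma commute_word_eval phi w g :
  (forall x, commute g (phi x)) -> commute g (word_eval phi w).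
Proof.
by move=> c; apply: commute_prod => l _; case: ifP => // _; apply: commuteV.
Qed.

(** The commutation lets each [phi'] factor pass the later [phi] factors. It serves for letters
    whose images have values at two positions of a wreath product. *)
Lemma word_eval_mul phi phi' w :
  (forall x y, commute (phi' x) (phi y)) ->
  word_eval (fun x => phi x * phi' x) w = word_eval phi w * word_eval phi' w.
Proof.
move=> c; elim: w => [|[x b] w IH]; first by rewrite !word_eval_nil mulg1.
rewrite !word_eval_cons IH /=.
have cw : commute (if b then phi' x else (phi' x)^-1) (word_eval phi w).
  apply: commute_word_eval => y; case: b; first exact: c.
  by apply/commute_sym/commuteV/commute_sym; apply: c.
have -> : (if b then phi x * phi' x else (phi x * phi' x)^-1) =
          (if b then phi x else (phi x)^-1) * (if b then phi' x else (phi' x)^-1).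
  by case: b {cw} => //; rewrite -invgM (c x x).
by rewrite -!mulgA; congr (_ * _); rewrite !mulgA cw.
Qed.

(** Von Dyck's principle: a map that kills the relators factors through the presented group. *)
Lemma word_eval_eq phi (R : set (word X)) u v :
  (forall r, R r -> word_eval phi r = 1) -> word_eq R u v ->
  word_eval phi u = word_eval phi v.
Proof.
move=> phiR; elim=> // {u v}.
- by move=> u v w _ -> _ ->.
- move=> u v [x b]; rewrite !word_eval_cat; congr (_ * _).
  rewrite !word_eval_cons word_eval_nil mulg1 /=.
  by case: b; rewrite ?mulgV ?mulVg mul1g.
- by move=> u v r Rr; rewrite !word_eval_cat (phiR r Rr) mul1g.
Qed.

End Words.

Lemma word_eval_morph (X : Type) (G H : groupType) (f : G -> H)
    (phi : X -> G) (w : word X) :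
  {morph f : x y / x * y} -> f (word_eval phi w) = word_eval (f \o phi) w.
Proof.
move=> fM; elim: w => [|l w IH]; first by rewrite !word_eval_nil morph_group1.
by rewrite !word_eval_cons fM IH; case: ifP => // _; rewrite morph_groupV.
Qed.

(** * The group defined by generators and relators *)

Section Presented.
Variables (X : Type) (R : set (word X)).
Implicit Types u v w : word X.

Lemma word_eq_catl u v w : word_eq R v w -> word_eq R (u ++ v) (u ++ w).
Proof.
elim=> {v w}.
- by move=> v; apply: word_eq_refl.
- by move=> v w _; apply: word_eq_sym.
- by move=> v w s _ H1 _; apply: word_eq_trans H1.
- by move=> v w l; rewrite !catA -catA; apply: word_eq_free.
- by move=> v w r Rr; rewrite !catA -catA; apply: word_eq_rel.
Qed.

Lemma word_eq_catr u v w : word_eq R v w -> word_eq R (v ++ u) (w ++ u).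
Proof.
elim=> {v w}.
- by move=> v; apply: word_eq_refl.
- by move=> v w _; apply: word_eq_sym.
- by move=> v w s _ H1 _; apply: word_eq_trans H1.
- by move=> v w l; rewrite -!catA; apply: word_eq_free.
- by move=> v w r Rr; rewrite -!catA; apply: word_eq_rel.
Qed.

Lemma word_eq_mulV w : word_eq R (w ++ word_inv w) [::].
Proof.
elim: w => [|l w IH]; first exact: word_eq_refl.
rewrite /word_inv /= rev_cons -cats1 -/(word_inv w).
apply: (@word_eq_trans _ _ _ ([:: l] ++ [:: letter_inv l])); last first.
  exact: (@word_eq_free _ R [::] [::] l).
have := word_eq_catl [:: l] (word_eq_catr [:: letter_inv l] IH).
by rewrite -!catA.
Qed.

Lemma word_invK : involutive (@word_inv X).
Proof.
move=> w; rewrite /word_inv map_rev revK -map_comp -[RHS]map_id.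
exact/eq_map/letter_invK.
Qed.

Lemma word_eq_mulVg w : word_eq R (word_inv w ++ w) [::].
Proof. by rewrite -{2}(word_invK w); apply: word_eq_mulV. Qed.

Lemma word_eq_inv u v : word_eq R u v -> word_eq R (word_inv u) (word_inv v).
Proof.
move=> uv; apply: (@word_eq_trans _ _ _ (word_inv u ++ (v ++ word_inv v))).
  rewrite -{1}(cats0 (word_inv u)); apply/word_eq_catl/word_eq_sym.
  exact: word_eq_mulV.
rewrite catA -[X in word_eq R _ X]cat0s; apply: word_eq_catr.
apply: word_eq_trans (word_eq_mulVg u).
exact/word_eq_catl/word_eq_sym.
Qed.

(** An element is an equivalence class of words, taken as a predicate, so that equality of elements
    follows from extensionality. *)
Definition pres_group : Type :=
  {c : set (word X) | exists u, c = word_eq R u}.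

HB.instance Definition _ := gen_eqMixin pres_group.
HB.instance Definition _ := gen_choiceMixin pres_group.

Definition pres_class u : pres_group :=
  exist _ (word_eq R u) (ex_intro _ u erefl).

Definition pres_repr (c : pres_group) : word X := projT1 (cid (projT2 c)).

Lemma pres_classP u v : pres_class u = pres_class v <-> word_eq R u v.
Proof.
split=> [[e]|uv]; first by rewrite -/(word_eq R u v) e; apply: word_eq_refl.
apply: eq_exist; apply/funext => w; apply/propext.
split; last exact: word_eq_trans.
by apply: word_eq_trans; apply: word_eq_sym.
Qed.

Lemma pres_reprK : cancel pres_repr pres_class.
Proof.
by case=> c ec; apply: eq_exist; rewrite /pres_repr /=; case: cid => u /= ->.
Qed.

Lemma pres_reprP u : word_eq R (pres_repr (pres_class u)) u.
Proof. by apply/pres_classP; rewrite pres_reprK. Qed.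

Definition pres_one := pres_class [::].
Definition pres_mul c d := pres_class (pres_repr c ++ pres_repr d).
Definition pres_inv c := pres_class (word_inv (pres_repr c)).

Lemma pres_mulE u v :
  pres_mul (pres_class u) (pres_class v) = pres_class (u ++ v).
Proof.
apply/pres_classP; apply: word_eq_trans (word_eq_catl u (pres_reprP v)).
exact/word_eq_catr/pres_reprP.
Qed.

Lemma pres_invE u : pres_inv (pres_class u) = pres_class (word_inv u).
Proof. exact/pres_classP/word_eq_inv/pres_reprP. Qed.

Fact pres_mulA : associative pres_mul.
Proof.
move=> a b c; rewrite -(pres_reprK a) -(pres_reprK b) -(pres_reprK c).
by rewrite !pres_mulE catA.
Qed.

Fact pres_mul1 : left_id pres_one pres_mul.
Proof. by move=> a; rewrite -(pres_reprK a) pres_mulE. Qed.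

Fact pres_mulg1 : right_id pres_one pres_mul.
Proof. by move=> a; rewrite -(pres_reprK a) pres_mulE cats0. Qed.

Fact pres_mulV : left_inverse pres_one pres_inv pres_mul.
Proof.
move=> a; rewrite -(pres_reprK a) pres_invE pres_mulE.
exact/pres_classP/word_eq_mulVg.
Qed.

Fact pres_mulgV : right_inverse pres_one pres_inv pres_mul.
Proof.
move=> a; rewrite -(pres_reprK a) pres_invE pres_mulE.
exact/pres_classP/word_eq_mulV.
Qed.

HB.instance Definition _ := isGroup.Build pres_group
  pres_mulA pres_mul1 pres_mulg1 pres_mulV pres_mulgV.

Definition pres_gen (x : X) : pres_group := pres_class (word_gen x).

Lemma word_eval_pres_gen w : word_eval pres_gen w = pres_class w.
Proof.
elim: w => [|[x b] w IH]; first by rewrite word_eval_nil.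
rewrite word_eval_cons IH -cat1s.
case: b; first exact: pres_mulE.
have -> : [:: (x, false)] = word_inv (word_gen x) by [].
by rewrite -pres_mulE -pres_invE.
Qed.

Lemma pres_evalP w : word_eval pres_gen w = 1 <-> consequence R w.
Proof. by rewrite word_eval_pres_gen; apply: pres_classP. Qed.

Lemma pres_rel r : R r -> word_eval pres_gen r = 1.
Proof.
move=> Rr; apply/pres_evalP; rewrite /consequence.
by have := word_eq_rel [::] [::] Rr; rewrite cats0.
Qed.

End Presented.

(** * Wreath products of two groups *)

Section WreathFacts.
Variables H G : groupType.
Local Notation W := (wreath H G).
Local Notation "f $ a" := (fpower_app f a) (at level 9, a at level 9).
Implicit Types (u v : W) (h k : H) (a b g : G) (f : fpower H G).

Lemma wreath_eqP u v :
  wreath_base u = wreath_base v -> wreath_top u = wreath_top v -> u = v.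
Proof. by case: u v => [? ?] [? ?] /= -> ->. Qed.

Lemma wreath_mulE u v :
  u * v = WreathElt (wreath_base u * fpower_act (wreath_top u) (wreath_base v))
                    (wreath_top u * wreath_top v).
Proof. by []. Qed.

Lemma wreath_inrM : {morph @wreath_inr H G : a b / a * b}.
Proof. by move=> a b; rewrite wreath_mulE /= fpower_act_one mulg1. Qed.

Definition wreath_at h a : W := WreathElt (fpower_at h a) 1.

Lemma wreath_atM a : {morph wreath_at^~ a : h k / h * k}.
Proof.
move=> h k; apply: wreath_eqP; rewrite wreath_mulE /= ?mulg1 // fpower_act1.
apply: fpowerP => b; rewrite fpowerME !fpower_atE.
by case: ifP; rewrite ?mulg1.
Qed.

Lemma wreath_inlM : {morph @wreath_inl H G : h k / h * k}.
Proof. exact: wreath_atM. Qed.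

Lemma wreath_at_inj a : injective (wreath_at^~ a).
Proof. by move=> h k [/(congr1 (fun f => f $ a))]; rewrite !fpower_atE eqxx. Qed.

Lemma wreath_atJ h a g : wreath_at h a ^ wreath_inr H g = wreath_at h (a * g).
Proof. exact: wreath_conj. Qed.

Lemma wreath_at_commute h k a b :
  a <> b -> commute (wreath_at h a) (wreath_at k b).
Proof.
move=> ab; apply: wreath_eqP => //=; rewrite !fpower_act1.
apply: fpowerP => c; rewrite !fpowerME !fpower_atE.
by case: eqP => [->|_]; case: eqP => // _; rewrite !gsimp.
Qed.

(** Conjugation by g moves the second element from position 1 to position g, and elements of the
    base with disjoint supports commute. *)
Lemma wreath_inl_commute h k g :
  g <> 1 -> commute (wreath_inl G h) (wreath_inl G k ^ wreath_inr H g).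
Proof.
move=> g1; rewrite -[wreath_inl G k]/(wreath_at k 1) wreath_atJ mul1g.
by apply: wreath_at_commute => /esym.
Qed.

(* [f] is the product of its values, each placed at its own position. *)
Lemma wreath_generated (S : set W) :
  is_subgroup S -> (forall h, S (wreath_inl G h)) ->
  (forall g, S (wreath_inr H g)) -> S = setT.
Proof.
case=> S1 SM SV Sl Sr; apply/seteqP; split=> // -[f g] _.
have SE f' : S (WreathElt f' 1) -> S (WreathElt f' g).
  move=> Sf; suff -> : WreathElt f' g = WreathElt f' 1 * wreath_inr H g.
    exact: SM.
  by rewrite wreath_mulE /= fpower_act_one mulg1 mul1g.
apply: SE.
have Sat h a : S (wreath_at h a).
  rewrite -[a]mul1g -wreath_atJ; apply: (SM); first exact: SV.
  by apply: (SM); first exact: Sl.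
have [n] := ubnP #|` finsupp f|; elim: n f => // n IH f fn.
have [f0|[c cf]] := fset_0Vmem (finsupp f).
  suff e1 : f = 1 by rewrite e1.
  by apply: fpowerP => b; rewrite fpower1E fpower_out ?f0.
(* Splitting off the value at c leaves a function with smaller support. *)
pose f' : fpower H G := fpower_at (f $ c)^-1 c * f.
have -> : WreathElt f 1 = wreath_at (f $ c) c * WreathElt f' 1.
  apply: wreath_eqP; rewrite wreath_mulE //= ?mulg1 // fpower_act1.
  apply: fpowerP => b; rewrite !fpowerME !fpower_atE.
  by case: eqP => [->|_]; rewrite ?mulVKg // !mul1g.
apply: SM => //; apply: IH.
apply: leq_trans (_ : #|` finsupp f| <= n)%N; last by [].
apply: fproper_ltn_card; rewrite fproperE; apply/andP; split.
  apply/fsubsetP => b; rewrite !mem_finsupp -!/(fpower_app _ _) fpowerME.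
  by rewrite fpower_atE; case: (b =P c) => [->|_]; rewrite ?mulVg ?eqxx ?mul1g.
apply/fsubsetPn; exists c => //.
by rewrite mem_finsupp -/(fpower_app _ _) fpowerME fpower_atE eqxx mulVg eqxx.
Qed.

End WreathFacts.

(** * Words in the generators of a wreath product and their images in another group *)

Section WreathWords.
Variables (Y X Z : Type) (H G Q : groupType).
Variables (p : Y -> H) (q : X -> G) (bet : Y -> Q) (del : X -> Q).
Variables (psi : Z -> wreath H G) (gam : Z -> Q).
(** [psi] evaluates letters in the wreath product, [gam] in a group Q. The hypotheses express that Q
    satisfies the relations of H, those of G, and the commutation relations of the wreath
    product. *)
Hypothesis base_sound : forall b, word_eval p b = 1 -> word_eval bet b = 1.
Hypothesis top_sound : forall a, word_eval q a = 1 -> word_eval del a = 1.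
Hypothesis conj_commute : forall y y' a, word_eval q a <> 1 ->
  commute (bet y) (bet y' ^ word_eval del a).
Hypothesis letterP : forall z,
  (exists y, psi z = wreath_inl G (p y) /\ gam z = bet y) \/
  (exists x, psi z = wreath_inr H (q x) /\ gam z = del x).

Local Notation conj_pair l := (word_eval bet l.1 ^ word_eval del l.2).
Implicit Types L : seq (word Y * word X).

(** Conjugating back by the first conjugator leaves a single conjugator c, nontrivial in G. Then
    [conj_commute] extends from letters to words, one argument at a time. *)
Lemma word_conj_commute b b' a a' : word_eval q a <> word_eval q a' ->
  commute (conj_pair (b, a)) (conj_pair (b', a')).
Proof.
move=> aa' /=; pose c := a' ++ word_inv a.
have qc : word_eval q c <> 1.
  by rewrite word_eval_cat word_eval_inv => /divg1_eq /esym.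
suff: commute (word_eval bet b) (word_eval bet b' ^ word_eval del c).
  move/(commute_conj (word_eval del a)).
  by rewrite -conjgM word_eval_cat word_eval_inv mulgVK.
apply: commute_sym; apply: commute_word_eval => y; apply: commute_sym.
have cM : {morph conjg^~ (word_eval del c) : u v / u * v}.
  by move=> u v; rewrite conjMg.
rewrite (word_eval_morph bet b' cM).
by apply: commute_word_eval => y'; apply: conj_commute.
Qed.

Lemma top_eq a a' :
  word_eval q a = word_eval q a' -> word_eval del a = word_eval del a'.
Proof.
move=> e; apply: divg1_eq; rewrite -word_eval_inv -word_eval_cat.
by apply: top_sound; rewrite word_eval_cat word_eval_inv e mulgV.
Qed.

(* Factors with different conjugators commute; those with the same conjugator
   merge into one conjugate, whose base word is trivial.                       *)
Lemma conj_prod_trivial L :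
  (forall g, \prod_(l <- L | word_eval q l.2 == g) word_eval p l.1 = 1) ->
  \prod_(l <- L) conj_pair l = 1.
Proof.
have [n] := ubnP (size L); elim: n L => // n IH [|l0 L0] sL.
  by rewrite big_nil.
set L := l0 :: L0 in sL * => prod1; set g0 := word_eval q l0.2.
pose P := [pred l : word Y * word X | word_eval q l.2 == g0].
(* Factors with conjugator value g0 move to the left; the others form a shorter list, because the
   head of L is taken out. *)
have splitL L' : \prod_(l <- L') conj_pair l =
    \prod_(l <- L' | P l) conj_pair l * \prod_(l <- L' | ~~ P l) conj_pair l.
  elim: L' => [|l L' IHL]; first by rewrite !big_nil mulg1.
  rewrite !big_cons IHL; case: ifP => /= Pl; first by rewrite mulgA.
  suff cl : commute (conj_pair l) (\prod_(l' <- L' | P l') conj_pair l').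
    by rewrite [LHS]mulgA cl -mulgA.
  apply: commute_prod => l' Pl'.
  case: l l' Pl Pl' => [b a] [b' a'] /= Pl Pl'; apply: word_conj_commute.
  by move=> e; move: Pl; rewrite e Pl'.
rewrite splitL -[X in _ * X]big_filter IH ?mulg1.
- rewrite (eq_bigr (fun l => word_eval bet l.1 ^ word_eval del l0.2)).
    rewrite -conjg_prod -big_filter; set s := [seq _ <- _ | _].
    have evalE (K : groupType) (f : Y -> K) :
        \prod_(l <- s) word_eval f l.1 = word_eval f (flatten (map fst s)).
      elim: s => [|l s IHs]; first by rewrite big_nil word_eval_nil.
      by rewrite big_cons IHs /= word_eval_cat.
    rewrite evalE base_sound ?conj1g // -evalE big_filter.
    exact: prod1.
  by move=> l /eqP/top_eq ->.
- rewrite -ltnS; apply: leq_trans sL; rewrite 2!ltnS size_filter /= eqxx /= add0n.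
  exact: count_size.
(* At g0 the filtered list contributes nothing; at any other g the filter changes nothing. *)
- move=> g; rewrite big_filter_cond; have [->|gg0] := eqVneq g g0.
    by rewrite big_pred0 // => l /=; rewrite andNb.
  rewrite -[RHS](prod1 g); apply: eq_bigl => l /=.
  by case: (_ =P g) => [->|]; rewrite ?andbF ?gg0.
Qed.

Definition letter (K : groupType) (c : bool) (k : K) := if c then k else k^-1.

Lemma letter_eval (T : Type) (K : groupType) (f : T -> K) c t :
  word_eval f [:: (t, c)] = letter c (f t).
Proof. by rewrite word_eval_cons word_eval_nil mulg1. Qed.

Lemma letter_morph (K K' : groupType) (f : K -> K') c k :
  {morph f : u v / u * v} -> letter c (f k) = f (letter c k).
Proof. by case: c => // fM; rewrite /letter morph_groupV. Qed.

Lemma wreath_word_normal_form w : exists L a,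
  [/\ forall g, fpower_app (wreath_base (word_eval psi w)) g =
        \prod_(l <- L | word_eval q l.2 == g) word_eval p l.1,
      wreath_top (word_eval psi w) = word_eval q a &
      word_eval gam w = \prod_(l <- L) conj_pair l * word_eval del a].
Proof.
elim: w => [|[z c] w [L [a [fE gE wE]]]].
  exists [::], [::]; rewrite !word_eval_nil big_nil mulg1; split=> // g.
  by rewrite big_nil fpower1E.
rewrite !word_eval_cons -!/(letter _ _) wE /=.
have [[y [-> ->]]|[x [-> ->]]] := letterP z.
  exists (([:: (y, c)], [::]) :: L), a.
  rewrite (letter_morph _ _ (@wreath_inlM H G)); split=> [g||].
  - rewrite fpowerME fpower_act1 fE fpower_atE big_cons /=.
    by rewrite word_eval_nil letter_eval eq_sym; case: ifP; rewrite ?mul1g.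
  - by rewrite mul1g.
  - by rewrite big_cons /= word_eval_nil conjg1 letter_eval mulgA.
(* Moving the new letter l to the right uses l b^a = b^(a l^-1) l, hence the inverse letter
   [(x, ~~ c)] at the end of every conjugator. *)
exists [seq (l.1, l.2 ++ [:: (x, ~~ c)]) | l <- L], ((x, c) :: a).
have letterV (K : groupType) (k : K) : letter (~~ c) k = (letter c k)^-1.
  by case: c; rewrite /letter /= ?invgK.
rewrite (letter_morph _ _ (@wreath_inrM H G)); split=> [g||].
- rewrite mul1g fpower_actE fE big_map; apply: eq_bigl => l /=.
  by rewrite word_eval_cat letter_eval letterV divg_eq.
- by rewrite word_eval_cons gE.
- rewrite big_map word_eval_cons -/(letter _ _) [LHS]mulgA [RHS]mulgA.
  congr (_ * _); under [X in _ = X * _]eq_bigr => l _.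
    rewrite /= word_eval_cat letter_eval letterV conjgM; over.
  by rewrite -conjg_prod -conjgCV.
Qed.

Lemma wreath_word_sound w : word_eval psi w = 1 -> word_eval gam w = 1.
Proof.
have [L [a [fE gE ->]]] := wreath_word_normal_form w; move=> w1.
rewrite conj_prod_trivial ?mul1g.
  by apply: top_sound; rewrite -gE w1.
by move=> g; rewrite -fE w1 fpower1E.
Qed.

End WreathWords.

(** * Iterated wreath products *)

Section IterWreath.
Variable G : nat -> groupType.

Lemma iter_embed_gt k i (g : G i) : (k < i)%N -> iter_embed k g = 1.
Proof.
elim: k => [|k IH] ki /=; case: eqP => [e|_] //.
- by exfalso; rewrite e in ki.
- by exfalso; rewrite e ltnn in ki.
- by rewrite IH 1?ltnW // (morph_group1 (@wreath_inlM _ _)).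
Qed.

Lemma iter_embedM k i : {morph @iter_embed G k i : g h / g * h}.
Proof.
elim: k => [|k IH] g h /=; case: eqP => [e|_].
- by case: _ / e.
- by rewrite mulg1.
- by case: _ / e; apply: wreath_inrM.
- by rewrite IH wreath_inlM.
Qed.

Lemma iter_embed_inj k i : (i <= k)%N -> injective (@iter_embed G k i).
Proof.
elim: k => [|k IH] ik g h.
  by case: i ik g h => // _ g h; rewrite !iter_embed_last.
move: ik; rewrite leq_eqVlt => /predU1P[e|ik].
  by move: g h; rewrite e => g h; rewrite !iter_embed_last => -[].
by rewrite !iter_embedS // => /wreath_at_inj/IH; apply.
Qed.

(** At k = j this is the commutation in a single wreath product; each further level carries it along
    the homomorphism [wreath_inl]. *)
Lemma iter_embed_commute k i1 i2 j (g1 : G i1) (g2 : G i2) (g : G j) :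
  (i1 < j)%N -> (i2 < j)%N -> (j <= k)%N -> g <> 1 ->
  commute (iter_embed k g1) (iter_embed k g2 ^ iter_embed k g).
Proof.
move=> i1j i2j jk g_neq1; elim: k jk => [|k IH] jk.
  by case: j g i1j {i2j g_neq1} jk.
move: jk; rewrite leq_eqVlt => /predU1P[e|jk].
  clear IH; move: g g_neq1; rewrite e => g g_neq1; rewrite e in i1j i2j.
  by rewrite iter_embed_last !iter_embedS //; apply: wreath_inl_commute.
rewrite ltnS in jk.
rewrite !iter_embedS ?(ltnW (leq_trans i1j jk)) ?(ltnW (leq_trans i2j jk)) //.
rewrite -(morph_groupJ (@wreath_inlM _ _)).
exact: (morph_commute (@wreath_inlM _ _) (IH jk)).
Qed.

End IterWreath.

(** The level 0 counterpart of [wreath_word_sound]: there is one group, and letters of higher levels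
    are trivial under both maps. *)
Lemma word_eval_sound_on (Z X : Type) (G Q : groupType) (q : X -> G)
    (del : X -> Q) (psi : Z -> G) (gam : Z -> Q) :
  (forall a, word_eval q a = 1 -> word_eval del a = 1) ->
  (forall z, psi z = 1 /\ gam z = 1 \/
             exists x, psi z = q x /\ gam z = del x) ->
  forall w, word_eval psi w = 1 -> word_eval gam w = 1.
Proof.
move=> qdel letterP w.
suff [a [-> ->]] : exists a, word_eval psi w = word_eval q a /\
                             word_eval gam w = word_eval del a by apply: qdel.
elim: w => [|[z c] w [a [IHp IHg]]]; first by exists [::]; rewrite !word_eval_nil.
rewrite !word_eval_cons IHp IHg /=.
have [[-> ->]|[x [-> ->]]] := letterP z; last first.
  by exists ((x, c) :: a); rewrite !word_eval_cons.
by exists a; rewrite !invg1 !if_same !mul1g.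
Qed.

Lemma generates_sub (G : groupType) (A S : set G) :
  generates A -> is_subgroup S -> A `<=` S -> forall g, S g.
Proof.
by move=> genA subS AS g; apply: (smallest_sub subS AS); rewrite genA.
Qed.

(** * Generators of the iterated wreath product *)

Section UnionWords.
Variables (m : nat) (G : nat -> groupType) (X : nat -> Type).
Variable phi : forall i, X i -> G i.
Arguments phi : clear implicits.

Lemma union_map_word_map (i : 'I_m.+1) (r : word (X i)) :
  word_eval (@union_map m G X phi) (word_map (@union_inj m X i) r) =
  iter_embed m (word_eval (phi i) r).
Proof. by rewrite word_eval_map (word_eval_morph _ _ (@iter_embedM G m i)). Qed.

Lemma union_map_comm (j : 'I_m.+1) (x y : union_gen m X) (a : word (X j)) :
  (projT1 x < j)%N -> (projT1 y < j)%N -> word_eval (phi j) a <> 1 ->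
  word_eval (@union_map m G X phi) (word_comm (word_gen x)
    (word_conj (word_gen y) (word_map (@union_inj m X j) a))) = 1.
Proof.
move=> xj yj a1; rewrite word_eval_comm word_eval_conj !word_eval_gen.
rewrite union_map_word_map; apply/eqP/commgP.
by apply: iter_embed_commute => //; rewrite -ltnS ltn_ord.
Qed.

Lemma union_map_generates :
  (forall i : 'I_m.+1, generates (range (phi i))) ->
  generates (range (@union_map m G X phi)).
Proof.
(* S varies, so that the induction hypothesis applies to the preimage of S under [wreath_inl]. *)
move=> genG; suff gen k (S : set (iter_wreath G k)) : (k <= m)%N ->
    is_subgroup S -> (forall z : union_gen m X, (projT1 z <= k)%N ->
      S (iter_embed k (phi (projT1 z) (projT2 z)))) -> forall g, S g.
  apply/seteqP; split=> // g _ S [subS rangeS]; apply: (gen m) => // z _.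
  by apply: rangeS; exists z.
elim: k S => [|k IH] S km subS Sgen.
  apply: (generates_sub (genG ord0)) => // _ [x _ <-].
  by have := Sgen (@union_inj m X ord0 x) isT; rewrite iter_embed_last.
pose j : 'I_m.+1 := Ordinal (km : (k.+1 < m.+1)%N).
have [S1 SM SV] := subS.
suff -> : S = setT by [].
apply: wreath_generated => // [h|g].
  apply: (IH (fun h => S (wreath_inl (G k.+1) h))) => [||z zk].
  - exact: ltnW km.
  - split=> [|x y|x]; first by rewrite (morph_group1 (@wreath_inlM _ _)).
      by rewrite wreath_inlM; apply: SM.
    by rewrite (morph_groupV (@wreath_inlM _ _)); apply: SV.
  - by rewrite -iter_embedS //; apply: Sgen; apply: leqW.
apply: (generates_sub (genG j) (S := fun g => S (wreath_inr _ g))).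
  split=> [|x y|x]; first by rewrite (morph_group1 (@wreath_inrM _ _)).
    by rewrite wreath_inrM; apply: SM.
  by rewrite (morph_groupV (@wreath_inrM _ _)); apply: SV.
move=> _ [x _ <-]; have := Sgen (@union_inj m X j x) (leqnn _).
by rewrite iter_embed_last.
Qed.

End UnionWords.

(** * Closures, consequences and the projection to the top group *)

Lemma smallest_is_subgroup (G : groupType) (A : set G) :
  is_subgroup (smallest (@is_subgroup G) A).
Proof.
split=> [S [[]] //|x y Sx Sy S hS|x Sx S hS]; case: (hS) => [[_ SM SV] _].
  by apply: SM; [apply: Sx|apply: Sy].
by apply: SV; apply: Sx.
Qed.

Lemma normal_closure_normal (G : groupType) (A : set G) :
  is_normal_subgroup (normal_closure A).
Proof.
split=> [|x g Nx S hS]; last by case: (hS) => [[_ SJ] _]; apply: SJ; apply: Nx.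
split=> [S [[[]]] //|x y Nx Ny S hS|x Nx S hS]; case: (hS) => [[[_ SM SV] _] _].
  by apply: SM; [apply: Nx|apply: Ny].
by apply: SV; apply: Nx.
Qed.

Lemma sub_consequence (X : Type) (R R' : set (word X)) w :
  R `<=` R' -> consequence R w -> consequence R' w.
Proof.
move=> RR'; rewrite -!pres_evalP => w1; rewrite pres_evalP.
have := word_eval_eq (phi := pres_gen R') _ ((pres_evalP R w).1 w1).
by rewrite word_eval_nil => e; apply/pres_evalP/e => r /RR'; apply: pres_rel.
Qed.

Section IterTop.
Variable G : nat -> groupType.

Definition iter_top k : iter_wreath G k -> G k :=
  match k with
  | 0 => id
  | k'.+1 => @wreath_top (iter_wreath G k') (G k'.+1)
  end.

Lemma iter_topM k : {morph @iter_top k : g h / g * h}.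
Proof. by case: k. Qed.

Lemma iter_top_last k (g : G k) : iter_top (iter_embed k g) = g.
Proof. by rewrite iter_embed_last; case: k g. Qed.

Lemma iter_top_lt k i (g : G i) : (i < k)%N -> iter_top (iter_embed k g) = 1.
Proof. by case: k => // k ik; rewrite iter_embedS. Qed.

End IterTop.

(** * The presentation of the iterated wreath product *)

Section IterWreathPresentation.
Variables (m : nat) (G : nat -> groupType) (X : nat -> Type).
Variables (phi : forall i, X i -> G i) (R : forall i, set (word (X i))).
Variables (T : forall i, set (G i)) (tw : forall i, G i -> word (X i)).
Arguments phi : clear implicits.
Arguments R : clear implicits.
Arguments T : clear implicits.
Arguments tw : clear implicits.
Hypothesis presG : forall i : 'I_m.+1, is_presentation (phi i) (R i).
Hypothesis Tcover : forall j : 'I_m.+1, (0 < j)%N ->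
  T j `|` [set t^-1 | t in T j] = [set g | g <> 1].
Hypothesis twE : forall (j : 'I_m.+1) (t : G j), (0 < j)%N -> T j t ->
  word_eval (phi j) (tw j t) = t.

Local Notation U := (union_gen m X).
Local Notation rel := (@wreath_relators m G X R T tw).
Local Notation lev z := (nat_of_ord (projT1 z)).
Implicit Types z : U.

Lemma union_levelP z (j : 'I_m.+1) :
  lev z = j -> exists x : X j, z = @union_inj m X j x.
Proof. by case: z => i x /= /val_inj ij; case: _ / ij; exists x. Qed.

Definition level_map k z : iter_wreath G k :=
  iter_embed k (phi (projT1 z) (projT2 z)).

Lemma relators_word_sound_in (Q : groupType) (gam : U -> Q)
    (i : 'I_m.+1) (a : word (X i)) :
  (forall w, rel w -> word_eval gam w = 1) ->
  word_eval (phi i) a = 1 -> word_eval (gam \o @union_inj m X i) a = 1.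
Proof.
move=> gamrel /(presG i).2 consa.
rewrite (word_eval_eq _ consa) ?word_eval_nil // => r Rr.
by rewrite -word_eval_map; apply: gamrel; left; exists i, r.
Qed.

(** If a represents t in T_j, this is a relator. If it represents t^-1, the relator with z and z'
    exchanged is conjugated by t^-1. *)
Lemma relators_conj_commute (Q : groupType) (gam : U -> Q) (j : 'I_m.+1)
    z z' (a : word (X j)) :
  (forall w, rel w -> word_eval gam w = 1) ->
  (lev z < j)%N -> (lev z' < j)%N -> word_eval (phi j) a <> 1 ->
  commute (gam z) (gam z' ^ word_eval (gam \o @union_inj m X j) a).
Proof.
move=> gamrel zj z'j a1; have j0 : (0 < j)%N := leq_ltn_trans (leq0n _) zj.
have comT y y' t : (lev y < j)%N -> (lev y' < j)%N -> T j t ->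
    commute (gam y) (gam y' ^ word_eval (gam \o @union_inj m X j) (tw j t)).
  move=> yj y'j Tt; apply/commgP/eqP.
  rewrite -word_eval_map -(word_eval_gen gam y) -(word_eval_gen gam y').
  rewrite -word_eval_conj -word_eval_comm; apply: gamrel.
  by right; exists j, y, y', t.
have : [set g | g <> 1] (word_eval (phi j) a) by [].
(* The relators of level j make the choice of a word for an element immaterial. *)
have eq_tw b : word_eval (phi j) a = word_eval (phi j) b ->
    word_eval (gam \o @union_inj m X j) a =
    word_eval (gam \o @union_inj m X j) b.
  move=> ab; apply: divg1_eq; rewrite -word_eval_inv -word_eval_cat.
  apply: relators_word_sound_in => //.
  by rewrite word_eval_cat word_eval_inv ab mulgV.
rewrite -Tcover // => -[Ta|[t Tt ta]].
  by rewrite (eq_tw (tw j (word_eval (phi j) a))) ?twE //; apply: comT.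
rewrite (eq_tw (word_inv (tw j t))) ?word_eval_inv ?twE //.
have := comT z' z t z'j zj Tt.
move/(commute_conj (word_eval (gam \o @union_inj m X j) (tw j t))^-1).
by rewrite conjgK => /commute_sym.
Qed.

Lemma union_map_word_sound (Q : groupType) (gam : U -> Q) :
  (forall w, rel w -> word_eval gam w = 1) ->
  forall w, word_eval (@union_map m G X phi) w = 1 -> word_eval gam w = 1.
Proof.
(* Letters above level k go to 1, as under [iter_embed], so one alphabet serves all levels of the
   induction. *)
move=> gamrel; pose gam' k z := if (lev z <= k)%N then gam z else 1.
have level_gt k z : (k < lev z)%N -> level_map k z = 1 /\ gam' k z = 1.
  by move=> kz; rewrite /gam' leqNgt kz /level_map iter_embed_gt.
have sound k : (k <= m)%N ->
    forall w, word_eval (level_map k) w = 1 -> word_eval (gam' k) w = 1.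
  elim: k => [|k IH] km.
    apply: (word_eval_sound_on (q := phi 0%N) (del := gam \o @union_inj m X ord0)).
      by move=> a; apply: (@relators_word_sound_in _ _ ord0).
    move=> z; case: (posnP (lev z)) => [z0|z0].
      right; have [x ->] := @union_levelP z ord0 z0; exists x.
      by rewrite /level_map iter_embed_last.
    by left; have [] := level_gt 0%N z z0.
  pose j := Ordinal (km : (k.+1 < m.+1)%N).
  apply: (@wreath_word_sound U (X k.+1) U (iter_wreath G k) (G k.+1) Q
    (level_map k) (phi k.+1) (gam' k) (gam \o @union_inj m X j)).
  - exact: IH (ltnW km).
  - by move=> a; apply: (@relators_word_sound_in _ _ j).
  - move=> y y' a a1; rewrite /gam'.
    case: leqP => yk; last exact/commute_sym/commute1.
    case: leqP => y'k; last by rewrite conj1g; apply: commute1.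
    exact: (@relators_conj_commute _ _ j).
  - move=> z; case: (ltngtP (lev z) k.+1) => zk.
    + left; exists z; rewrite /level_map /gam' iter_embedS ?ltnS //.
      by rewrite ltnW // -ltnS zk.
    (* A letter above level k + 1 counts as a base letter with trivial image. *)
    + left; exists z; have [-> ->] := level_gt _ _ zk.
      have [-> ->] := level_gt _ _ (ltnW zk).
      by rewrite (morph_group1 (@wreath_inlM _ _)).
    + right; have [x ->] := @union_levelP z j zk; exists x.
      by rewrite /level_map iter_embed_last /gam' /= leqnn.
move=> w; have := sound m (leqnn m) w.
rewrite (eq_word_eval (phi' := @union_map m G X phi)) //.
rewrite (eq_word_eval w (phi' := gam)) //.
by move=> z; rewrite /gam' -ltnS ltn_ord.
Qed.

Lemma T_neq1 (j : 'I_m.+1) t : (0 < j)%N -> T j t -> t <> 1.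
Proof.
by move=> j0 Tt; have := Tcover j0; rewrite predeqE => /(_ t) [+ _]; apply; left.
Qed.

(** Taking for Q in [union_map_word_sound] the group presented by [rel] shows that words trivial in
    the wreath product are consequences of [rel]. *)
Lemma wreath_presentation :
  is_presentation (@union_map m G X phi) rel.
Proof.
split=> [|w]; first by apply: union_map_generates => i; case: (presG i).
split=> [w1|/word_eval_eq ->].
- apply/pres_evalP; apply: union_map_word_sound w1.
  by move=> r; apply: pres_rel.
- by rewrite word_eval_nil.
move=> _ [[i [r [Rr ->]]]|[j [x [y [t [j0 xj yj Tt ->]]]]]].
  rewrite union_map_word_map; suff -> : word_eval (phi i) r = 1.
    exact: morph_group1 (@iter_embedM _ _ _).
  by apply/(presG i).2; apply/pres_evalP; apply: pres_rel.
by apply: union_map_comm => //; rewrite twE //; apply: T_neq1.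
Qed.

(** * Cyclic quotients and conormality *)

Section Kill.
Variable z : U.

(* Adding all other generators as relators leaves the cyclic quotient of W
   generated by [z].                                                         *)
Definition kill_relators : set (word U) :=
  rel `|` [set w | exists2 z' : U, z' <> z & w = word_gen z'].

Definition kill_gen : U -> pres_group kill_relators := pres_gen kill_relators.

Lemma kill_rel w : rel w -> word_eval kill_gen w = 1.
Proof. by move=> rw; apply: pres_rel; left. Qed.

Lemma kill_other z' : z' <> z -> kill_gen z' = 1.
Proof.
move=> zz'; rewrite -(word_eval_gen kill_gen z').
by apply: pres_rel; right; exists z'.
Qed.

End Kill.

(** Congruence modulo N passes from letters to words; this takes the place of computing in K/N. *)
Lemma normal_word_eval (Y : Type) (K : groupType) (N : set K) (f g : Y -> K) w :
  is_normal_subgroup N -> (forall y, N (f y * (g y)^-1)) ->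
  N (word_eval f w * (word_eval g w)^-1).
Proof.
move=> [[N1 NM NV] NJ] fg; elim: w => [|[y c] w IH].
  by rewrite !word_eval_nil mulgV.
have Nc : N ((if c then f y else (f y)^-1) * (if c then g y else (g y)^-1)^-1).
  case: c => //; have := NJ _ (f y) (NV _ (fg y)).
  by rewrite conjgE invgM !invgK !mulgA mulgVK.
rewrite !word_eval_cons /= invgM.
have := NM _ _ Nc (NJ _ (if c then g y else (g y)^-1)^-1 IH).
by rewrite conjgE invgK !mulgA mulgVK.
Qed.

(** Let c send z to [phi i x] and every other generator to 1. All relators of the cyclic quotient
    evaluate under c into the normal closure N of the other generators of G_i, so triviality of z
    would put [phi i x] in N. *)
Lemma kill_gen_neq1 (i : 'I_m.+1) (x : X i) :
  is_conormal (phi i) -> kill_gen (@union_inj m X i x) (@union_inj m X i x) <> 1.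
Proof.
set z := union_inj x => /(_ x) conorm; rewrite -(word_eval_gen (kill_gen z) z).
move/pres_evalP => triv; apply: conorm.
set N := normal_closure _.
have nN : is_normal_subgroup N := normal_closure_normal _.
have [[N1 NM NV] NJ] := nN.
pose c (z' : U) : G i := if pselect (z' = z) then phi i x else 1.
have cz : c z = phi i x by rewrite /c; case: pselect.
have cN z' : z' <> z -> c z' = 1 by rewrite /c; case: pselect.
have c_level (i' : 'I_m.+1) (a : word (X i')) :
    i' <> i -> word_eval c (word_map (@union_inj m X i') a) = 1.
  move=> ii'; rewrite word_eval_map -[RHS](word_eval_1 _ a).
  by apply: eq_word_eval => y /=; apply: cN => /(congr1 (@projT1 _ _)).
have rN r : kill_relators z r -> N (word_eval c r).
  case=> [[[i' [r' [Rr ->]]]|[j [y [y' [t [j0 yj y'j Tt ->]]]]]]|[z' zz' ->]].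
  - have [ii'|] := pselect (i' = i); last by move/c_level ->.
    case: _ / (esym ii') r' Rr => {i' ii'} r' Rr.
    have r'1 : word_eval (phi i) r' = 1.
      by apply/(presG i).2; apply/pres_evalP; apply: pres_rel.
    (* [c] and [phi i] agree modulo N on X_i, and r' has value 1 under [phi i]. *)
    rewrite word_eval_map -[word_eval _ _]mulg1 -invg1 -r'1.
    apply: (normal_word_eval r' nN) => y /=; have [->|yx] := pselect (y = x).
      by rewrite cz mulgV.
    rewrite cN ?mul1g; last by move=> yz; apply: yx; apply: existT_inj2 yz.
    by apply: NV; move=> S [_]; apply; exists y.
  - rewrite word_eval_comm word_eval_conj !word_eval_gen.
    (* For j = i the entries lie below level i, where c is 1. Otherwise the conjugator becomes 1,
       and each entry is 1 or [c z]. *)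
    have [ji|/c_level ->] := pselect (j = i).
      rewrite cN ?comm1g // => yz; move: yj; rewrite yz ji /=.
      by rewrite ltnn.
    rewrite conjg1; have [->|/cN ->] := pselect (y = z); last by rewrite comm1g.
    by have [->|/cN ->] := pselect (y' = z); rewrite ?commg1 ?commgg.
  - by rewrite word_eval_gen cN.
suff inv u v : word_eq (kill_relators z) u v ->
    N (word_eval c u * (word_eval c v)^-1).
  by have := inv _ _ triv; rewrite word_eval_gen word_eval_nil cz invg1 mulg1.
elim=> {u v}.
- by move=> u; rewrite mulgV.
- by move=> u v _ /NV; rewrite invgM invgK.
- by move=> u v w _ uv _ vw; have := NM _ _ uv vw; rewrite mulgA mulgVK.
- move=> u v [y b]; rewrite !word_eval_cat !word_eval_cons word_eval_nil /=.
  by case: b; rewrite mulg1 ?mulgV ?mulVg mul1g mulgV.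
- move=> u v r /rN /(NJ _ (word_eval c u)^-1).
  by rewrite conjgE invgK !word_eval_cat invgM !mulgA mulgK.
Qed.

(** * Minimality of the generators and of the relators *)

(** [iter_top] sends all lower generators to 1, so a generating Y would yield a proper subset of X_m
    that generates G_m. *)
Lemma top_generators_minimal (Y : set U) (x : X m) :
  (forall Y' : set (X m), (Y' `<` setT)%classic -> ~ generates (phi m @` Y')) ->
  ~ Y (@union_inj m X ord_max x) -> ~ generates (@union_map m G X phi @` Y).
Proof.
move=> minG nYx genY.
pose Y' : set (X m) := [set y | Y (@union_inj m X ord_max y)].
apply: (minG Y'); first by split=> // /(_ x I).
apply/seteqP; split=> // g _; rewrite -(iter_top_last g).
have subT := smallest_is_subgroup (phi m @` Y').
have [S1 SM SV] := subT.
apply: (generates_sub genY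
  (S := fun u => smallest (@is_subgroup (G m)) (phi m @` Y') (iter_top u))).
  split=> [|u v|u]; first by rewrite (morph_group1 (@iter_topM _ _)).
    by rewrite iter_topM; apply: SM.
  by rewrite (morph_groupV (@iter_topM _ _)); apply: SV.
move=> _ [z Yz <-]; rewrite /union_map.
have [zm|zm] := ltnP (projT1 z) m; first by rewrite iter_top_lt.
have ezm : projT1 z = @ord_max m :> nat.
  by apply/eqP; rewrite eqn_leq zm -ltnS ltn_ord.
have [y ey] := @union_levelP z ord_max ezm; rewrite ey in Yz *.
by rewrite iter_top_last; apply: sub_gen_smallest; exists y.
Qed.

(** If Y generates, z equals a word w over Y in the wreath product. The cyclic quotient respects
    this equality and kills w, hence z. *)
Lemma conormal_generators_minimal (Y : set U) z :
  kill_gen z z <> 1 -> ~ Y z -> ~ generates (@union_map m G X phi @` Y).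
Proof.
move=> z1 nYz genY; apply: z1.
have [w wz w1] : exists2 w, word_eval (@union_map m G X phi) w =
    union_map phi z & word_eval (kill_gen z) w = 1.
  apply: (generates_sub genY (S := fun g => exists2 w,
    word_eval (@union_map m G X phi) w = g & word_eval (kill_gen z) w = 1)).
    split=> [|_ _ [u <- u1] [v <- v1]|_ [u <- u1]].
    - by exists [::]; rewrite !word_eval_nil.
    - by exists (u ++ v); rewrite word_eval_cat // u1 v1 mulg1.
    - by exists (word_inv u); rewrite word_eval_inv // u1 invg1.
  move=> _ [y Yy <-]; exists (word_gen y); rewrite word_eval_gen //.
  by apply: kill_other => yz; rewrite yz in Yy.
have: word_eval (union_map phi) (word_inv w ++ word_gen z) = 1.
  by rewrite word_eval_cat word_eval_inv word_eval_gen wz mulVg.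
move/(union_map_word_sound (@kill_rel z)).
by rewrite word_eval_cat word_eval_inv word_eval_gen w1 invg1 mul1g.
Qed.

(* The model is the wreath product of the groups presented without [r], in
   which the words [tw j t] stay nontrivial.                                 *)
Lemma group_relator_independent (i : 'I_m.+1) (r : word (X i)) :
  ~ consequence (R i `\ r)%classic r ->
  ~ consequence (rel `\ word_map (@union_inj m X i) r)%classic
      (word_map (@union_inj m X i) r).
Proof.
move=> indep cons.
(* Relators of different levels have different types; the tag lets r be removed from its own level
   only. *)
pose tag k (s : word (X k)) : {k : nat & word (X k)} := existT _ k s.
pose R' k : set (word (X k)) := [set s | R k s /\ tag k s <> tag i r].
pose G' k : groupType := pres_group (R' k).
pose phi' k : X k -> G' k := pres_gen (R' k).
have : word_eval (@union_map m G' X phi') (word_map (@union_inj m X i) r) = 1.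
  rewrite (word_eval_eq _ cons) ?word_eval_nil // => w [relw nw].
  case: relw nw => [[i' [s [Rs ->]]]|[j [x [y [t [j0 xj yj Tt ->]]]]]] nw.
    rewrite union_map_word_map (_ : word_eval _ _ = 1).
      exact: morph_group1 (@iter_embedM _ _ _).
    apply: pres_rel; split=> // ers; apply: nw.
    have /val_inj ii' : val i' = val i := congr1 (@projT1 _ _) ers.
    case: _ / (esym ii') s Rs ers => s _ ers.
    by congr (word_map _ _); apply: existT_inj2 ers.
  (* The word for t stays nontrivial, since consequences of [R' j] are consequences of [R j]. *)
  apply: union_map_comm => //= t1; apply: (T_neq1 j0 Tt); rewrite -(twE j0 Tt).
  apply/(presG j).2; apply: sub_consequence ((pres_evalP _ _).1 t1).
  by move=> s [].
rewrite union_map_word_map => e1.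
have /pres_evalP : word_eval (phi' i) r = 1.
  apply: (@iter_embed_inj G' m i); first by rewrite -ltnS ltn_ord.
  by rewrite e1 (morph_group1 (@iter_embedM _ _ _)).
move=> consr; apply: indep; apply: sub_consequence consr => s [Rs sr].
by split=> // es; apply: sr; rewrite es.
Qed.

(** The images lie in the iterated wreath product of the groups Q wr G_k: generators below level j
    inside Q wr G_j, the others in their own top groups. Commutator relators of levels above j then
    hold by [iter_embed_commute]. *)
Lemma comm_relator_independent (j : 'I_m.+1) (x y : U) (t : G j) :
  let w := word_comm (word_gen x)
    (word_conj (word_gen y) (word_map (@union_inj m X j) (tw j t))) in
  (T j `&` [set t^-1 | t in T j] = set0)%classic ->
  (0 < j)%N -> (lev x < j)%N -> (lev y < j)%N -> T j t ->
  kill_gen x x <> 1 -> kill_gen y y <> 1 ->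
  ~ consequence (rel `\ w)%classic w.
Proof.
move=> w0 Tdisj j0 xj yj Tt kx ky cons.
have t1 := T_neq1 j0 Tt; have jm : (j <= m)%N by rewrite -ltnS ltn_ord.
pose Q : groupType := wreath (pres_group (kill_relators x))
                             (pres_group (kill_relators y)).
pose alpha z : Q := wreath_inr _ (kill_gen y z).
pose beta z : Q := wreath_inl _ (kill_gen x z).
pose G' k : groupType := wreath Q (G k).
pose base z : G' j := wreath_at (alpha z) 1 * wreath_at (beta z) t.
pose psi z : iter_wreath G' m :=
  if (lev z < j)%N then iter_embed m (base z)
  else iter_embed m (wreath_inr Q (phi (lev z) (projT2 z))).
have psi_lt (i : 'I_m.+1) (r : word (X i)) : (i < j)%N ->
    word_eval psi (word_map (@union_inj m X i) r) =
    iter_embed m (word_eval base (word_map (@union_inj m X i) r)).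
  move=> ij; rewrite !word_eval_map (word_eval_morph _ _ (@iter_embedM G' m j)).
  by apply: eq_word_eval => v /=; rewrite /psi /= ij.
have psi_ge (i : 'I_m.+1) (r : word (X i)) : (j <= i)%N ->
    word_eval psi (word_map (@union_inj m X i) r) =
    iter_embed m (wreath_inr Q (word_eval (phi i) r)).
  move=> ji; rewrite word_eval_map (word_eval_morph _ _ (@wreath_inrM Q (G i))).
  rewrite (word_eval_morph _ _ (@iter_embedM G' m i)).
  by apply: eq_word_eval => v /=; rewrite /psi /= ltnNge ji.
(* Since t is not 1, [base] is a product of two commuting maps, each factoring through its own
   cyclic quotient. *)
have base1 w : word_eval (kill_gen x) w = 1 -> word_eval (kill_gen y) w = 1 ->
    word_eval base w = 1.
  move=> xw yw; rewrite word_eval_mul; last first.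
    by move=> *; apply: wreath_at_commute.
  have at1 (a : G j) (f : U -> Q) : word_eval f w = 1 ->
      word_eval (fun z => wreath_at (f z) a) w = 1.
    move=> fw; rewrite -[LHS](word_eval_morph _ _ (@wreath_atM Q (G j) a)) fw.
    exact: morph_group1 (@wreath_atM _ _ _).
  rewrite !at1 ?mulg1 //.
    rewrite -[LHS](word_eval_morph _ _ (@wreath_inlM _ _)) xw.
    exact: morph_group1 (@wreath_inlM _ _).
  rewrite -[LHS](word_eval_morph _ _ (@wreath_inrM _ _)) yw.
  exact: morph_group1 (@wreath_inrM _ _).
have embed1 k i : iter_embed k (1 : G' i) = 1.
  exact: morph_group1 (@iter_embedM _ _ _).
have baseJ z s : base z ^ wreath_inr Q s =
    wreath_at (alpha z) s * wreath_at (beta z) (t * s).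
  by rewrite conjMg !wreath_atJ mul1g.
have psiJ x' y' s : (lev x' < j)%N -> (lev y' < j)%N -> T j s ->
    word_eval psi (word_comm (word_gen x')
      (word_conj (word_gen y') (word_map (@union_inj m X j) (tw j s)))) =
    iter_embed m [~ base x', base y' ^ wreath_inr Q s].
  move=> x'j y'j Ts; rewrite word_eval_comm word_eval_conj !word_eval_gen.
  rewrite psi_ge // twE // /psi x'j y'j.
  by rewrite (morph_groupR (@iter_embedM _ _ _)) (morph_groupJ (@iter_embedM _ _ _)).
have commQ u v a b : a <> b -> commute (wreath_at u a : G' j) (wreath_at v b).
  exact: wreath_at_commute.
(* If t s = 1, then s lies both in T_j and in its set of inverses. *)
have tV s : T j s -> t * s <> 1.
  move=> Ts /mulg1_eq ts; have : set0 s by rewrite -Tdisj; split=> //; exists t.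
  by [].
have : word_eval psi w0 = 1.
  rewrite (word_eval_eq _ cons) ?word_eval_nil // => w [relw nw].
  move: relw (relw) nw.
  case=> [[i [r [Rr ->]]]|[k [x' [y' [s [k0 x'k y'k Ts ->]]]]]] relw nw.
    have [ij|ji] := ltnP i j.
      rewrite psi_lt // base1 //; exact: kill_rel.
    rewrite psi_ge // (_ : word_eval _ _ = 1).
      by rewrite (morph_group1 (@wreath_inrM _ _)).
    by apply/(presG i).2; apply/pres_evalP; apply: pres_rel.
  have [kj|jk|/val_inj kj] := ltngtP (val k) (val j).
  - have := base1 _ (kill_rel x relw) (kill_rel y relw).
    rewrite !word_eval_comm !word_eval_conj !word_eval_gen psi_lt //.
    rewrite /psi !(ltn_trans _ kj) // -(morph_groupJ (@iter_embedM _ _ _)).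
    by rewrite -(morph_groupR (@iter_embedM _ _ _)) => ->.
  - rewrite word_eval_comm word_eval_conj !word_eval_gen psi_ge ?(ltnW jk) //.
    rewrite twE //; apply/eqP/commgP.
    have inr1 : wreath_inr Q s <> 1 by case=> s1; apply: (T_neq1 k0 Ts).
    rewrite /psi; case: ifP => _; case: ifP => _;
      by apply: iter_embed_commute; rewrite // -ltnS ltn_ord.
  - clear relw; case: _ / (esym kj) s Ts x'k y'k nw => {kj k0} s Ts x'j y'j nw.
    rewrite psiJ // baseJ (_ : [~ _, _] = 1) //; apply/eqP/commgP.
    have comm4 (a b c d : G' j) : commute a c -> commute a d -> commute b c ->
        commute b d -> commute (a * b) (c * d).
      move=> ac ad bc bd.
      by apply/commute_sym; apply: commuteM; apply/commute_sym; apply: commuteM.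
    (* Positions 1 and t meet positions s and t s; only t and s can coincide. *)
    apply: comm4; [apply: (commQ)|apply: (commQ)| |apply: (commQ)].
    + by move=> e; apply: (T_neq1 j0 Ts).
    + by move=> e; apply: (tV s).
    + have [st|st] := pselect (s = t); last by apply: (commQ) => /esym.
      rewrite {}st in nw *; rewrite {Ts}.
      (* With s = t, the pair commutes unless x' = x and y' = y, which is the dropped relator. *)
      have [ex|/kill_other ex] := pselect (x' = x); last first.
        rewrite /beta ex (morph_group1 (@wreath_inlM _ _)).
        rewrite (morph_group1 (@wreath_atM _ _ _)).
        exact/commute_sym/commute1.
      have [ey|/kill_other ey] := pselect (y' = y).
        by case: nw; rewrite ex ey.
      rewrite /alpha ey (morph_group1 (@wreath_inrM _ _)).
      rewrite (morph_group1 (@wreath_atM _ _ _)).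
      exact: commute1.
    + by move=> e; apply: (T_neq1 j0 Ts); apply: (mulgI t); rewrite mulg1.
rewrite psiJ // -(embed1 m j) => /iter_embed_inj-/(_ jm)/eqP/commgP.
(* At position t only [beta x] and [alpha y] contribute, since t differs from 1 and from t t. *)
rewrite baseJ => /(congr1 (fun u => fpower_app (wreath_base u) t)).
have tt : (t == t * t) = false.
  by apply/eqP => e; apply: t1; apply: (mulgI t); rewrite mulg1.
have t1b : (t == 1) = false by apply/eqP.
rewrite /= !mulg1 !fpower_act1 !fpowerME !fpower_atE eqxx tt t1b !mulg1 !mul1g.
(* In K_x wr K_y the nontrivial image of y moves the entry of x away from position 1, so commuting
   would make the image of x trivial. *)
rewrite /alpha /beta => /(congr1 (fun u => fpower_app (wreath_base u) 1)).
rewrite /= !fpowerME fpower_act1 fpower_actE !fpower_atE !fpower1E mul1g mulg1 eqxx.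
by rewrite mul1g; case: eqP.
Qed.
End IterWreathPresentation.

Theorem theorem2 (m : nat) (G : nat -> groupType) (X : nat -> Type)
    (phi : forall i, X i -> G i)
    (R : forall i, set (word (X i)))
    (T : forall i, set (G i))
    (tw : forall i, G i -> word (X i))
    (presG : forall i : 'I_m.+1, is_presentation (phi i) (R i))
    (Tdisj : forall j : 'I_m.+1, (0 < j)%N ->
       T j `&` [set t^-1 | t in T j] = set0)
    (Tcover : forall j : 'I_m.+1, (0 < j)%N ->
       T j `|` [set t^-1 | t in T j] = [set g | g <> 1])
    (twE : forall (j : 'I_m.+1) (t : G j), (0 < j)%N -> T j t ->
       word_eval (phi j) (tw j t) = t) :
  is_presentation (@union_map m G X phi) (@wreath_relators m G X R T tw) /\
  ((forall i : 'I_m.+1, is_minimal_presentation (phi i) (R i)) ->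
   (forall i : 'I_m.+1, (i < m)%N -> is_conormal (phi i)) ->
   is_minimal_presentation (@union_map m G X phi)
     (@wreath_relators m G X R T tw)).
Proof.
split=> [|minG conorm]; first exact: wreath_presentation.
(* Conormality enters here; it serves the generators below level m and the two entries of each
   commutator relator, whose levels are below j <= m. *)
have kill1 (z : union_gen m X) :
    (projT1 z < m)%N -> kill_gen R T tw z z <> 1.
  by case: z => i x /= im; apply: kill_gen_neq1 => //; apply: conorm.
split; first exact: wreath_presentation.
- move=> Y [_ /existsNP[z /not_implyP[_ nYz]]].
  have [zm|zm] := ltnP (projT1 z) m.
    exact: conormal_generators_minimal (kill1 z zm) nYz.
  have ezm : projT1 z = @ord_max m :> nat.
    by apply/eqP; rewrite eqn_leq zm -ltnS ltn_ord.
  have [x ex] := @union_levelP m X z ord_max ezm; rewrite ex in nYz.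
  by apply: top_generators_minimal nYz; case: (minG ord_max).
- move=> _ [[i [r [Rr ->]]]|[j [x [y [t [j0 xj yj Tt ->]]]]]].
    by apply: group_relator_independent => //; case: (minG i) => _ _; apply.
  have jm : (j <= m)%N by rewrite -ltnS ltn_ord.
  apply: comm_relator_independent => //; first exact: Tdisj.
    exact/kill1/(leq_trans xj).
  exact/kill1/(leq_trans yj).
Qed.
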